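(* Let $\mathbf{G}$ be a finite connected MW-graph with combinatorial weights having $m$ edges and a maximal $d$-clique. Assume that $m<(d-1)(d+2)/2$. Then $d$ is in the spectrum of $\mathbf{G}$ with multiplicity at least $$\frac{(d-1)(d+2)}2-m=d-r-1,$$ where $r=m-d(d-1)/2$ is the number of edges of the underlying graph $G$ not in the clique.
   Context: A graph $G=(V,E,\partial)$ consists of disjoint sets $V$ (vertices) and $E$ (edges), a map $\partial\colon E\to V\times V$, $\partial e=(\partial_-e,\partial_+e)$, and an involution $e\mapsto\bar e$ on $E$ with $e\neq\bar e$ and $\partial_\pm\bar e=\partial_\mp e$. Loops and multiple edges are allowed; finite means that $V$ is finite, and every vertex $v$ has finite degree $|E_v|$, where $E_v=\{e\in E:\partial_-e=v\}$. The number $m$ of edges is counted without orientation, i.e. $e$ and $\bar e$ count as one edge (so the complete graph $K_d$ has $d(d-1)/2$ edges). A magnetic weighted graph (MW-graph) with combinatorial weights is a graph $G$ with all vertex and edge weights equal to $1$ and a magnetic potential $\alpha\colon E\to R$, $\alpha_{\bar e}=-\alpha_e$, where $R$ is a subgroup of $\mathbb{R}/2\pi\mathbb{Z}$; it is connected if $G$ is. Its spectrum is the list of eigenvalues, with multiplicity, of the magnetic Laplacian $(\Delta_\alpha\varphi)(v)=\sum_{e\in E_v}\bigl(\varphi(v)-\mathrm{e}^{\mathrm{i}\alpha_e}\varphi(\partial_+e)\bigr)$ for $\varphi\colon V\to\mathbb{C}$. For $d\in\mathbb{N}$, a $d$-clique of $G$ is an induced subgraph $G[V_0]$ (vertex set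 $V_0\subset V$ and all edges of $G$ with both endpoints in $V_0$) that is isomorphic to the complete graph $K_d$ of order $d=|V_0|$. A $d$-clique is maximal if it is not a subgraph of a $(d+1)$-clique of $G$. The notion is extended to MW-graphs by restricting the weights and the magnetic potential to the corresponding subgraph.
   Formalization: The magnetic potential restricted to the clique is additionally assumed gauge equivalent to zero (no flux through its cycles); without this the claim fails, e.g. for K_3 with potential π on every edge, whose spectrum is 1, 1, 4. *)

(* Defs.v *)
From HB Require Import structures.
From mathcomp Require Import all_boot all_order all_algebra.
From mathcomp Require Import complex.
From mathcomp Require Import reals trigo.

Set Implicit Arguments.
Unset Strict Implicit.
Unset Printing Implicit Defensive.

Import Order.TTheory GRing.Theory Num.Theory.

Local Open Scope ring_scope.
Local Open Scope quotient_scope.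
Local Open Scope complex_scope.

(* Since V is finite and every vertex has finite degree, E is finite as well.
   The map bd is the boundary map, bd e = (initial vertex, terminal vertex);
   an unoriented edge is a pair {e, rev e}. *)
Record graph := Graph {
  vertex : finType;
  edge : finType;
  bd : edge -> vertex * vertex;
  rev : edge -> edge;
  revK : involutive rev;
  rev_neq : forall e, rev e != e;
  bd_rev : forall e, bd (rev e) = ((bd e).2, (bd e).1)
}.

Section GraphTheory.
Implicit Types G H : graph.

Definition out_edges G (v : vertex G) : {set edge G} :=
  [set e | (bd e).1 == v].

Definition unoriented G (e : edge G) : {set edge G} := [set e; rev e].

Definition nb_edges G : nat := #|[set unoriented e | e : edge G]|.

Definition graph_connected G : Prop :=
  forall v w : vertex G,
    connect (fun x y => [exists e : edge G, bd e == (x, y)]) v w.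

Definition graph_iso G H : Prop :=
  exists (f : vertex G -> vertex H) (g : edge G -> edge H),
    [/\ bijective f, bijective g,
        forall e, bd (g e) = (f (bd e).1, f (bd e).2) &
        forall e, g (rev e) = rev (g e)].

Section CompleteGraph.
Variable d : nat.

Definition complete_edge := {p : 'I_d * 'I_d | p.1 != p.2}.

Lemma complete_rev_subproof (e : complete_edge) :
  (val e).2 != ((val e).2, (val e).1).2.
Proof. by rewrite /= eq_sym (valP e). Qed.

Definition complete_rev (e : complete_edge) : complete_edge :=
  Sub ((val e).2, (val e).1) (complete_rev_subproof e).

Lemma complete_revK : involutive complete_rev.
Proof. by case=> [[i j] h]; apply: val_inj. Qed.

Lemma complete_rev_neq (e : complete_edge) : complete_rev e != e.
Proof.
apply/eqP => /(congr1 val); case: e => [[i j] /= h] [eij _].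
by rewrite eij eqxx in h.
Qed.

Definition complete_graph : graph :=
  @Graph 'I_d complete_edge val complete_rev
    complete_revK complete_rev_neq (fun=> erefl).

End CompleteGraph.

Section InducedSubgraph.
Variables (G : graph) (V0 : {set vertex G}).

Definition edge_in (e : edge G) : bool :=
  ((bd e).1 \in V0) && ((bd e).2 \in V0).

Definition induced_vertex := {v : vertex G | v \in V0}.
Definition induced_edge := {e : edge G | edge_in e}.

Lemma edge_in_fst (e : induced_edge) : (bd (val e)).1 \in V0.
Proof. by have /andP[] := valP e. Qed.

Lemma edge_in_snd (e : induced_edge) : (bd (val e)).2 \in V0.
Proof. by have /andP[] := valP e. Qed.

Lemma edge_in_rev (e : induced_edge) : edge_in (rev (val e)).
Proof. by rewrite /edge_in bd_rev edge_in_fst edge_in_snd. Qed.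

Definition induced_bd (e : induced_edge) : induced_vertex * induced_vertex :=
  (Sub (bd (val e)).1 (edge_in_fst e), Sub (bd (val e)).2 (edge_in_snd e)).

Definition induced_rev (e : induced_edge) : induced_edge :=
  Sub (rev (val e)) (edge_in_rev e).

Lemma induced_revK : involutive induced_rev.
Proof. by move=> e; apply: val_inj; rewrite /= revK. Qed.

Lemma induced_rev_neq (e : induced_edge) : induced_rev e != e.
Proof. by rewrite -val_eqE /= rev_neq. Qed.

Lemma induced_bd_rev (e : induced_edge) :
  induced_bd (induced_rev e) = ((induced_bd e).2, (induced_bd e).1).
Proof. by congr pair; apply: val_inj; rewrite /= bd_rev. Qed.

Definition induced : graph :=
  Graph induced_revK induced_rev_neq induced_bd_rev.

Definition nb_edges_outside : nat :=
  #|[set unoriented e | e : edge G & ~~ edge_in e]|.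

Definition is_clique (d : nat) : Prop :=
  #|V0| = d /\ graph_iso induced (complete_graph d).

End InducedSubgraph.

(* For induced subgraphs, being a subgraph amounts to inclusion of the vertex
   sets. *)
Definition is_maximal_clique G (V0 : {set vertex G}) (d : nat) : Prop :=
  is_clique V0 d /\
  ~ exists V1 : {set vertex G}, V0 \subset V1 /\ is_clique V1 d.+1.

End GraphTheory.

Section Circle.
Variable R : realType.

Definition two_pi_int (x : R) : bool := x / (2 * pi) \is a Num.int.

Lemma two_pi_int_closed : zmod_closed two_pi_int.
Proof.
have inE x : (x \in two_pi_int) = (x / (2 * pi) \is a Num.int) by [].
split=> [|x y]; rewrite !inE; first by rewrite mul0r rpred0.
by move=> hx hy; rewrite mulrBl rpredB.
Qed.

HB.instance Definition _ :=
  GRing.isZmodClosed.Build R two_pi_int two_pi_int_closed.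

(* R / 2 pi Z, as an additive group. *)
Definition circle := Quotient.quot (GRing.ZmodClosed.clone _ two_pi_int _).
HB.instance Definition _ := GRing.Zmodule.on circle.

(* e^{i a}; the choice of representative is immaterial, see expi_pi. *)
Definition expi (a : circle) : R[i] := cos (repr a) +i* sin (repr a).

Lemma cosin_int (x : R) (k : int) :
  cos (x + (pi *+ 2) *~ k) = cos x /\ sin (x + (pi *+ 2) *~ k) = sin x.
Proof.
case: k => n; first by rewrite !periodicn //; [exact: sinD2pi|exact: cosD2pi].
set y := x + _; have -> : x = y + pi *+ 2 *+ n.+1.
  by rewrite /y NegzE mulrNz addrNK.
by rewrite !periodicn //; [exact: sinD2pi|exact: cosD2pi].
Qed.

Lemma expi_pi (x : R) : expi (\pi_circle x) = cos x +i* sin x.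
Proof.
have /eqP := reprK (\pi_circle x); rewrite -Quotient.idealrBE.
move=> /intrP[k hk]; rewrite /expi.
have -> : repr (\pi_circle x) = x + (pi *+ 2) *~ k.
  rewrite -mulrzr -hk -[pi *+ 2]mulr_natl.
  rewrite mulrCA mulfV ?mulr1 ?subrKC //.
  by rewrite mulf_neq0 ?pnatr_eq0 ?gt_eqF ?pi_gt0.
by have [-> ->] := cosin_int x k.
Qed.

End Circle.

(* All vertex and edge weights are 1 (combinatorial weights), so only the
   magnetic potential, with values in a subgroup of R / 2 pi Z, is recorded. *)
Record mwgraph (R : realType) := MWGraph {
  ugraph :> graph;
  coef_group : zmodClosed (circle R);
  potential : edge ugraph -> circle R;
  potential_coef : forall e, potential e \in coef_group;
  potential_rev : forall e, potential (rev e) = - potential e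
}.

Section MWGraphTheory.
Variable R : realType.

Section Laplacian.
Variable G : mwgraph R.

Definition laplacian (phi : {ffun vertex G -> R[i]^o}) :
    {ffun vertex G -> R[i]^o} :=
  [ffun v => \sum_(e in out_edges v)
               (phi v - expi (potential e) * phi (bd e).2)].

Lemma laplacian_is_linear : linear laplacian.
Proof.
move=> a phi psi; apply/ffunP => v; rewrite !ffunE scaler_sumr -big_split /=.
apply: eq_bigr => e _; rewrite !ffunE scalerBr mulrDr opprD addrACA.
congr (_ - _ + _); exact: mulrCA.
Qed.

HB.instance Definition _ :=
  GRing.isLinear.Build R[i] {ffun vertex G -> R[i]^o}
    {ffun vertex G -> R[i]^o} _ laplacian laplacian_is_linear.

Definition in_spectrum (lambda : R[i]) : bool :=
  passmx.leigenvalue (linfun laplacian) lambda.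

(* The Laplacian is Hermitian, so that geometric and algebraic multiplicities
   agree; this is the geometric one. *)
Definition multiplicity (lambda : R[i]) : nat :=
  \dim (passmx.leigenspace (linfun laplacian) lambda).

End Laplacian.

Section InducedMWGraph.
Variables (G : mwgraph R) (V0 : {set vertex G}).

Definition induced_potential (e : edge (induced V0)) : circle R :=
  potential (val e).

Lemma induced_potential_rev (e : edge (induced V0)) :
  induced_potential (rev e) = - induced_potential e.
Proof. by rewrite /induced_potential /= potential_rev. Qed.

Definition mw_induced : mwgraph R :=
  @MWGraph R (induced V0) (coef_group G) induced_potential
    (fun e => potential_coef (val e)) induced_potential_rev.

End InducedMWGraph.

(* Complete graphs carry the zero potential, and a d-clique of an MW-graph is
   compared with K_d up to gauge: a flux through the clique can remove the
   eigenvalue d (on K_3 with potential pi on every edge, the spectrum of the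
   magnetic Laplacian is 1, 1, 4).  Cohomologous (gauge equivalent) to 0: the
   potential is the coboundary of a function on the vertices; equivalently, the
   flux through every cycle vanishes. *)
Definition cohomologous_to_zero (G : mwgraph R) : Prop :=
  exists xi : vertex G -> circle R,
    forall e : edge G, potential e = xi (bd e).2 - xi (bd e).1.

End MWGraphTheory.

(* Main.v *)
Require Import Defs.
From HB Require Import structures.
From mathcomp Require Import all_boot all_order all_algebra.
From mathcomp Require Import complex.
From mathcomp Require Import reals trigo.
From mathcomp Require Import zify lra.

Set Implicit Arguments.
Unset Strict Implicit.
Unset Printing Implicit Defensive.

Import Order.TTheory GRing.Theory Num.Theory.

Local Open Scope ring_scope.

(** Write C for the clique and call a vertex of C an exit if some edge leaves C
through it.  Suppose first that the potential vanishes on C, and let phi be a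
function that is supported on the vertices of C that are not exits and whose
values add up to 0.  No edge leaving C sees a nonzero value of phi, at either
end, so only the edges of C matter.  At a vertex v of C this gives
(d - 1) phi(v) - sum_(w in C, w <> v) phi(w) = d phi(v), and outside C the
Laplacian of phi is 0.  So phi is an eigenfunction for d.  A potential whose
flux through C is trivial, say the coboundary of xi on C, is removed by a
change of gauge: the condition on phi becomes
sum_(v in C) exp(i xi(v)) phi(v) = 0 (laplacian_clique).

These functions are cut out of the functions on C by one linear condition for
each exit and one for the sum (dim_supported_kernel).  An edge outside C has at
most one end in C, because C is induced, so there are at most r exits
(card_exit_vertices), and the multiplicity of d is at least d - r - 1
(multiplicity_clique).  Counting the d (d - 1) oriented edges of C turns this
into the bound in terms of m (nb_edges_clique); the assumption on m makes it
positive. *)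

(* Otherwise rev and revK are those of sequences. *)
Import Defs.

(** * Counting edges *)

(** The pairs {e, rev e} partition a set of edges that is stable under reversal,
and each has two elements because rev has no fixed point. *)
Lemma card_unoriented (G : graph) (A : {set edge G}) :
  {in A, forall e, rev e \in A} ->
  #|A| = (#|[set unoriented e | e in A]| * 2)%N.
Proof.
move=> revA; apply: card_uniform_partition => [_ /imsetP[e _ ->]|].
  by rewrite cards2 eq_sym rev_neq.
apply/and3P; split.
- rewrite eqEsubset; apply/andP; split; apply/subsetP => e.
    by case/bigcupP=> _ /imsetP[f fA ->] /set2P[]-> //; apply: revA.
  by move=> eA; apply/bigcupP; exists (unoriented e); rewrite ?imset_f ?set21.
- apply/trivIsetP => _ _ /imsetP[e _ ->] /imsetP[f _ ->].
  apply: contraR => /pred0Pn[g /andP[/= /set2P ge /set2P gf]].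
  have unorientedE e' : g = e' \/ g = rev e' -> unoriented e' = unoriented g.
    by case=> -> //; rewrite /unoriented revK setUC.
  by rewrite (unorientedE e) // (unorientedE f).
- by apply/imsetP => -[e _ /setP/(_ e)]; rewrite inE set21.
Qed.

(** * Edges of a clique *)

Section Clique.
Variables (G : graph) (V0 : {set vertex G}) (d : nat).
Hypothesis V0_clique : is_clique V0 d.

(** Together with clique_bd_image, this is all that is used of the isomorphism
with the complete graph: the edges of the clique are the ordered pairs of
distinct vertices. *)
Lemma clique_bd_inj : {in edge_in V0 &, injective (@bd G)}.
Proof.
case: V0_clique => _ [f [g [fbij gbij gbd _]]] e1 e2 in1 in2 eq12.
suff /(congr1 val) : Sub e1 in1 = Sub e2 in2 :> induced_edge V0 by [].
apply: (bij_inj gbij); apply: val_inj.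
rewrite [LHS](gbd (Sub e1 in1)) [RHS](gbd (Sub e2 in2)).
by congr (f _, f _); apply: val_inj; rewrite /= eq12.
Qed.

Lemma clique_bd_image :
  [set bd e | e in edge_in V0] = [set p in setX V0 V0 | p.1 != p.2].
Proof.
case: V0_clique => _ [f [g [fbij gbij gbd _]]].
apply/setP => -[v w]; rewrite !inE /=; apply/imsetP/idP.
  case=> e ein evw; have inE0 : edge_in V0 e := ein.
  have := inE0; rewrite /edge_in -evw /= => -> /=.
  have := valP (g (Sub e inE0)); have := gbd (Sub e inE0); rewrite /= => ->.
  apply: contra => /eqP vw; apply/eqP; congr f; apply: val_inj.
  by rewrite /= -evw.
case/andP=> /andP[vV wV] vw.
pose p : 'I_d * 'I_d := (f (Sub v vV), f (Sub w wV)).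
have fvw : p.1 != p.2.
  by rewrite /= (inj_eq (bij_inj fbij)).
have [h _ hK] := gbij.
pose e0 : edge (complete_graph d) := (Sub p fvw : complete_edge d).
exists (val (h e0)).
  exact: (valP (h e0)).
have := gbd (h e0); rewrite hK /= => -[].
move=> /(bij_inj fbij)/(congr1 val)/= -> /(bij_inj fbij)/(congr1 val)/= ->.
by case: (bd _).
Qed.

Lemma card_clique_edges : (#|[set e | edge_in V0 e]| + d = d * d)%N.
Proof.
have -> : #|[set e | edge_in V0 e]| = #|[set p in setX V0 V0 | p.1 != p.2]|.
  rewrite -clique_bd_image card_in_imset; last exact: clique_bd_inj.
  by apply: eq_card => e; rewrite inE.
have cardV0 : #|V0| = d by case: V0_clique.
have cardX : #|setX V0 V0| = (d * d)%N by rewrite cardsX cardV0.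
rewrite -cardX -(cardsID [set p | p.1 != p.2] (setX V0 V0)).
congr (_ + _)%N; first by apply: eq_card => p; rewrite !inE.
have diag_inj : injective (fun v : vertex G => (v, v)) by move=> v w [].
rewrite -[LHS]cardV0 -(card_imset _ diag_inj); apply: eq_card => -[v w].
rewrite !inE /= negbK; apply/imsetP/andP => [[u uV [-> ->]]|].
  by rewrite eqxx uV.
by case=> /eqP-> /andP[wV _]; exists w.
Qed.

(** Around a vertex of a clique, a sum over edges is a sum over the other
vertices; the Laplacian of the clique is evaluated in this form. *)
Lemma clique_sum (K : nmodType) (F : vertex G -> K) v : v \in V0 ->
  \sum_(e in out_edges v | edge_in V0 e) F (bd e).2 = \sum_(w in V0 :\ v) F w.
Proof.
move=> vV; pose B := [set e in out_edges v | edge_in V0 e].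
have -> : V0 :\ v = [set (bd e).2 | e in B].
  apply/setP => w; rewrite !inE; apply/andP/imsetP.
    case=> wv wV; have : (v, w) \in [set bd e | e in edge_in V0].
      by rewrite clique_bd_image !inE /= vV wV eq_sym.
    case/imsetP => e ein evw; exists e; last by rewrite -evw.
    by rewrite !inE -evw eqxx.
  case=> e; rewrite !inE => /andP[/eqP ev ein] ->.
  have : bd e \in [set bd e | e in edge_in V0] by apply: imset_f.
  by rewrite clique_bd_image !inE ev eq_sym => /andP[/andP[_ ->] ->].
rewrite big_imset /=; first by apply: eq_bigl => e; rewrite !inE.
move=> e f; rewrite !inE => /andP[/eqP ev ein] /andP[/eqP fv fin] ef.
apply: clique_bd_inj => //.
by rewrite [LHS]surjective_pairing [RHS]surjective_pairing ev fv ef.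
Qed.

End Clique.

(** * Edges outside the clique *)

Section Boundary.
Variables (G : graph) (V0 : {set vertex G}).

Definition exit_vertices : {set vertex G} :=
  [set v in V0 | [exists e in out_edges v, ~~ edge_in V0 e]].

Lemma edge_in_revE (e : edge G) : edge_in V0 (rev e) = edge_in V0 e.
Proof. by rewrite /edge_in bd_rev andbC. Qed.

Lemma card_outside_edges :
  #|[set e : edge G | ~~ edge_in V0 e]| = (nb_edges_outside V0).*2.
Proof.
rewrite card_unoriented => [|e]; last by rewrite !inE edge_in_revE.
by rewrite muln2.
Qed.

(** Every exit is the origin of an outside edge.  The reversal of such an edge
starts outside V0, since otherwise both ends would lie in V0; so the outside
edges that start in V0 are at most half of the oriented outside edges. *)
Lemma card_exit_vertices : (#|exit_vertices| <= nb_edges_outside V0)%N.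
Proof.
pose A := [set e : edge G | ((bd e).1 \in V0) && ~~ edge_in V0 e].
pose Out := [set e : edge G | ~~ edge_in V0 e].
have leTA : (#|exit_vertices| <= #|A|)%N.
  apply: leq_trans (leq_imset_card (fun e => (bd e).1) A).
  apply/subset_leq_card/subsetP => v; rewrite inE => /andP[vV].
  case/exists_inP => e; rewrite inE => /eqP ev eout.
  by apply/imsetP; exists e; rewrite ?inE ev ?vV.
have disjA : [disjoint A & @rev G @: A].
  apply/pred0P => e; apply/negP => /andP[/= eA /imsetP[f fA ef]].
  move: eA fA; rewrite !inE ef edge_in_revE bd_rev /= => /andP[f2 fout].
  by rewrite /edge_in f2 andbT andbN.
have subO : A :|: @rev G @: A \subset Out.
  apply/subsetP => e /setUP[|/imsetP[f + ->]]; rewrite !inE ?edge_in_revE;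
    by case/andP.
move: (subset_leq_card subO); rewrite cardsU (disjoint_setI0 disjA) cards0.
by rewrite (card_imset _ (inv_inj (@revK G))) card_outside_edges; lia.
Qed.

Lemma nb_edges_clique d : is_clique V0 d ->
  ((nb_edges G).*2 + d = d * d + (nb_edges_outside V0).*2)%N.
Proof.
move=> V0_clique; rewrite -(card_clique_edges V0_clique).
pose In := [set e : edge G | edge_in V0 e].
have cardT : #|[set: edge G]| = (nb_edges G).*2.
  rewrite card_unoriented => [|e _]; last by rewrite inE.
  rewrite muln2 /nb_edges; congr _.*2; apply: eq_card => X.
  by apply/imsetP/imsetP => -[e _ ->]; exists e.
rewrite -card_outside_edges -cardT cardsT -(cardsC In) addnAC.
by congr (_ + _ + _)%N; apply: eq_card => e; rewrite !inE.
Qed.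

End Boundary.

(** * Eigenfunctions supported in the clique *)

Section Support.
Variables (K : fieldType) (I : finType).

(** Functions supported on A that are killed by one linear form are the kernel
of a map to a space of dimension #|~: A| + 1, so they form a space of dimension
at least #|A| - 1. *)
Lemma dim_supported_kernel (A : {set I}) (c : I -> K)
    (U : {vspace {ffun I -> K^o}}) :
  (forall phi : {ffun I -> K^o}, (forall i, i \notin A -> phi i = 0) ->
     \sum_i c i * phi i = 0 -> phi \in U) ->
  (#|A| <= (\dim U).+1)%N.
Proof.
move=> hU.
pose J := {i : I | i \in ~: A}.
(* The coordinate None carries the linear form, the others the values of phi
   outside A. *)
pose F (phi : {ffun I -> K^o}) : {ffun option J -> K^o} :=
  [ffun j => if j is Some i then phi (val i) else \sum_i c i * phi i].
have F_lin : linear F.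
  move=> a phi psi; apply/ffunP => -[i|]; rewrite !ffunE //.
  rewrite scaler_sumr -big_split /=; apply: eq_bigr => i _.
  by rewrite !ffunE mulrDr; congr (_ + _); apply: mulrCA.
pose FL := GRing.isLinear.Build _ _ _ _ F F_lin.
pose Fl : {linear {ffun I -> K^o} -> {ffun option J -> K^o}} :=
  HB.pack F FL.
have kerU : (lker (linfun Fl) <= U)%VS.
  apply/subvP => phi; rewrite memv_ker lfunE => /eqP/ffunP phi0.
  apply: hU => [i iA|].
    have iAc : i \in ~: A by rewrite inE.
    by have := phi0 (Some (Sub i iAc)); rewrite !ffunE.
  by have := phi0 None; rewrite !ffunE.
apply: (@leq_trans (\dim (lker (linfun Fl))).+1); last by rewrite ltnS dimvS.
have := limg_ker_dim (linfun Fl) fullv; rewrite capfv.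
have := dimvS (subvf (limg (linfun Fl))).
rewrite !dimvf /dim /= !muln1 card_option card_sig.
rewrite -(cardsC A) -[#|[pred _ | _]|]/#|~: A|.
lia.
Qed.

End Support.

Section Eigenfunctions.
Variable R : realType.

Lemma expiD (a b : circle R) : expi (a + b) = expi a * expi b.
Proof.
rewrite -[a]reprK -[b]reprK.
have -> : \pi_(circle R)%qT (repr a) + \pi_(circle R)%qT (repr b) =
          \pi_(circle R)%qT (repr a + repr b) by rewrite !piE.
by rewrite !expi_pi cosD sinD; congr (_ +i* _)%C; rewrite addrC.
Qed.

Lemma expi0 : expi (0 : circle R) = 1.
Proof.
have -> : (0 : circle R) = \pi_(circle R)%qT 0 by rewrite !piE.
by rewrite expi_pi cos0 sin0.
Qed.

Variables (G : mwgraph R) (V0 : {set vertex G}) (d : nat).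
Hypothesis V0_clique : is_clique V0 d.
Variable xi : vertex G -> circle R.
Hypothesis potentialE : forall e : edge G, edge_in V0 e ->
  potential e = xi (bd e).2 - xi (bd e).1.

(** Outside edges contribute nothing, since phi vanishes at both of their ends
(at an exit, or outside V0).  For v in V0 the edges inside give
(d - 1) phi(v) minus the sum of exp(i (xi w - xi v)) phi(w) over w <> v; adding
and subtracting phi(v) completes that sum to exp(- i xi v) times the gauged sum
over V0, which is 0. *)
Lemma laplacian_clique (phi : {ffun vertex G -> R[i]^o}) :
    (forall v, v \notin V0 :\: exit_vertices V0 -> phi v = 0) ->
    \sum_(v in V0) expi (xi v) * phi v = 0 ->
  laplacian phi = d%:R *: phi.
Proof.
move=> phi0 sum0; apply/ffunP => v; rewrite !ffunE.
have cross w (e : edge G) : w \in V0 -> (bd e).1 = w -> ~~ edge_in V0 e ->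
    phi w = 0.
  move=> wV ew eout; apply: phi0; rewrite inE wV andbT negbK inE wV /=.
  by apply/exists_inP; exists e; rewrite // inE ew.
(* For v outside V0, an edge from v ends outside V0 or, when read backwards,
   shows that its end is an exit. *)
have [vV|vV] := boolP (v \in V0); last first.
  have phiv : phi v = 0 by apply: phi0; rewrite inE (negPf vV) andbF.
  rewrite phiv scaler0; apply: big1 => e; rewrite inE => /eqP ev.
  rewrite sub0r; suff -> : phi (bd e).2 = 0 by rewrite mulr0 oppr0.
  have [wV|wV] := boolP ((bd e).2 \in V0).
    apply: (cross _ (rev e)) => //; first by rewrite bd_rev.
    by rewrite edge_in_revE /edge_in ev (negPf vV).
  by apply: phi0; rewrite inE (negPf wV) andbF.
rewrite (bigID (edge_in V0)) /= [X in _ + X]big1 ?addr0; last first.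
  move=> e /andP[]; rewrite inE => /eqP ev eout.
  have -> : phi (bd e).2 = 0.
    apply: phi0; rewrite inE; move: eout; rewrite /edge_in ev vV /= => /negPf->.
    by rewrite andbF.
  by rewrite (cross v e) // mulr0 subr0.
(* F v = 0, so v itself may be added to the range of the sum. *)
pose F w := phi v - expi (xi w - xi v) * phi w.
rewrite (eq_bigr (fun e => F (bd e).2)); last first.
  by move=> e /andP[]; rewrite inE => /eqP ev ein; rewrite potentialE // ev.
rewrite (clique_sum V0_clique) //.
have Fv : F v = 0 by rewrite /F subrr expi0 mul1r subrr.
transitivity (\sum_(w in V0) F w).
  by rewrite [RHS](big_setD1 v) //= Fv add0r.
rewrite /F sumrB sumr_const; have [-> _] := V0_clique.
rewrite [X in _ - X](_ : _ =
  expi (- xi v) * \sum_(w in V0) expi (xi w) * phi w).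
  by rewrite sum0 mulr0 subr0 scaler_nat.
rewrite mulr_sumr; apply: eq_bigr => w _.
by rewrite mulrA -expiD addrC.
Qed.

Lemma multiplicity_clique :
  (d <= multiplicity G d%:R + nb_edges_outside V0 + 1)%N.
Proof.
pose c v : R[i] := if v \in V0 then expi (xi v) else 0.
have := @dim_supported_kernel _ _ (V0 :\: exit_vertices V0) c
  (passmx.leigenspace (linfun (@laplacian R G)) d%:R).
have cardV0 : #|V0| = d by case: V0_clique.
rewrite cardsD (setIidPr _) => [dimU|]; last by apply/subsetP => v /setIdP[].
rewrite cardV0 in dimU.
suff /dimU : forall phi : {ffun vertex G -> R[i]^o},
    (forall v, v \notin V0 :\: exit_vertices V0 -> phi v = 0) ->
    \sum_v c v * phi v = 0 ->
    phi \in passmx.leigenspace (linfun (@laplacian R G)) d%:R.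
  rewrite -[(\dim _).+1]/(multiplicity G d%:R).+1.
  by have := card_exit_vertices V0; lia.
move=> phi phi0 sum0.
rewrite memv_ker add_lfunE opp_lfunE scale_lfunE id_lfunE lfunE /=.
rewrite subr_eq0 laplacian_clique //; move: sum0.
rewrite (bigID (mem V0)) /= [X in _ + X]big1 ?addr0; last first.
  by move=> v vV; rewrite /c (negPf vV) mul0r.
by move=> sum0; rewrite -[RHS]sum0; apply: eq_bigr => v vV; rewrite /c vV.
Qed.

End Eigenfunctions.

(** The gauge is given on the vertices of the induced subgraph only; its values
elsewhere are arbitrary, and 0 is taken. *)
Lemma extend_gauge (R : realType) (G : mwgraph R) (V0 : {set vertex G}) :
  cohomologous_to_zero (mw_induced V0) ->
  exists xi : vertex G -> circle R, forall e : edge G, edge_in V0 e ->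
    potential e = xi (bd e).2 - xi (bd e).1.
Proof.
case=> xi xiE; exists (fun v => if insub v is Some u then xi u else 0) => e ein.
apply: etrans (xiE (Sub e ein)) _.
have /andP[e1 e2] := ein; rewrite !insubT /=.
by congr (xi _ - xi _); apply: val_inj.
Qed.

Theorem theorem5p2 (R : realType) (G : mwgraph R) (d m r : nat)
    (V0 : {set vertex G})
    (G_connected : graph_connected G)
    (m_edges : nb_edges G = m)
    (V0_clique : is_maximal_clique V0 d)
    (V0_flux : cohomologous_to_zero (mw_induced V0))
    (r_edges : nb_edges_outside V0 = r)
    (m_lt : (m%:Q < (d%:Q - 1) * (d%:Q + 2) / 2)%R) :
  [/\ r%:Q = m%:Q - d%:Q * (d%:Q - 1) / 2,
      (d%:Q - 1) * (d%:Q + 2) / 2 - m%:Q = d%:Q - r%:Q - 1,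
      in_spectrum G d%:R &
      (d%:Q - 1) * (d%:Q + 2) / 2 - m%:Q <= (multiplicity G d%:R)%:Q].
Proof.
have [clique _] := V0_clique; have [xi xiE] := extend_gauge V0_flux.
have := nb_edges_clique clique; rewrite m_edges r_edges => count.
have := multiplicity_clique clique xiE; rewrite r_edges => mult.
have countQ : m%:Q * 2 + d%:Q = d%:Q * d%:Q + r%:Q * 2.
  move/(congr1 (fun n : nat => n%:Q)): count.
  by rewrite -!muln2 !PoszD !PoszM !intrD !intrM.
have multQ : d%:Q <= (multiplicity G d%:R)%:Q + r%:Q + 1.
  by move: mult; rewrite -lez_nat -(ler_int rat) !PoszD !intrD.
have mult_gt0 : 0 < (multiplicity G d%:R)%:Q by nra.
split; [nra|nra| |nra].
rewrite /in_spectrum /passmx.leigenvalue -dimv_eq0.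
by rewrite -lt0n; move: mult_gt0; rewrite ltr0z.
Qed.
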